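(* Let $(M,\omega_M)$ be a compact connected Kähler manifold with constant scalar curvature. For every $m\ge d+1$, the set of points $(p_1,\dots,p_m)\in M^m$ for which $\mathfrak C_1(p_1,\dots,p_m)=d$ and $\mathfrak C_2(p_1,\dots,p_m)\neq0$ is open. Moreover, there exists $m_0\ge d+1$ such that, for all $m\ge m_0$, the set of points $(p_1,\dots,p_m)\in M^m$ for which $\mathfrak C_1=d$ and $\mathfrak C_2\ne0$ is nonempty.
   Context: Let $\mathbb L_M:=-\frac12\Delta_M^2-\mathrm{Ric}_M\cdot\nabla_M^2$, acting on real valued functions, where $\Delta_M$ is the Laplace–Beltrami operator, $\mathrm{Ric}_M$ the Ricci tensor, $\nabla_M^2$ the Hessian and $\cdot$ the full metric contraction, all with respect to the Riemannian metric induced by $\omega_M$. Let $\xi_0\equiv 1,\xi_1,\dots,\xi_d$ be a basis of the kernel of $\mathbb L_M$ with $\xi_1,\dots,\xi_d$ of mean $0$ over $M$ (so $d+1=\dim\ker\mathbb L_M$). Let $\mathfrak M(p_1,\dots,p_m)$ be the $d\times m$ real matrix with entries $\xi_i(p_j)$, $1\le i\le d$, $1\le j\le m$. Set $\mathfrak C_1:=\mathrm{Rank}\,\mathfrak M$ and $\mathfrak C_2:=\dim(K^m_+\cap\mathrm{Ker}\,\mathfrak M)$, where $K^m_+\subset\mathbb R^m$ is the cone of vectors with (strictly) positive entries; thus $\mathfrak C_2\neq0$ means that $\mathrm{Ker}\,\mathfrak M$ contains a vector all of whose entries are positive. *)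

(* Defs.v *)
From HB Require Import structures.
From mathcomp Require Export all_boot all_order all_algebra.
From mathcomp Require Export all_classical all_reals all_analysis.

Set Implicit Arguments.
Unset Strict Implicit.
Unset Printing Implicit Defensive.

Export Order.TTheory GRing.Theory Num.Theory.
Export numFieldNormedType.Exports.

Global Open Scope classical_set_scope.
Global Open Scope ring_scope.

(* Tensors in a coordinate domain of R^N.  Points and tangent vectors are row
   vectors; a bilinear form is the matrix B with B(u, v) = u *m B *m v^T. *)
Section Coordinates.
Context {R : realType} {N : nat}.
Implicit Types (U : set 'rV[R]_N) (f : 'rV[R]_N -> R) (x : 'rV[R]_N).
Implicit Types (g : 'rV[R]_N -> 'M[R]_N).

Definition partial (i : 'I_N) f : 'rV[R]_N -> R := 'D_(delta_mx 0 i) f.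

(* f is of class C^k on the open set U. *)
Fixpoint class_C (k : nat) U f : Prop :=
  (forall x, U x -> {for x, continuous f}) /\
  (if k is k'.+1 then
     forall i, (forall x, U x -> derivable f x (delta_mx 0 i)) /\
               class_C k' U (partial i f)
   else True).

Definition smooth_on U f : Prop := forall k, class_C k U f.

(* christoffel g k i j is the symbol with upper index k. *)
Definition christoffel g (k i j : 'I_N) x : R :=
  2^-1 * \sum_l invmx (g x) k l *
    (partial i (fun y => g y j l) x + partial j (fun y => g y i l) x
     - partial l (fun y => g y i j) x).

Definition ricci g x : 'M[R]_N := \matrix_(i, j)
  (\sum_k (partial k (christoffel g k i j) x
           - partial j (christoffel g k i k) x)
   + \sum_k \sum_l (christoffel g k k l x * christoffel g l i j x
                    - christoffel g k j l x * christoffel g l i k x)).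

Definition scalar_curv g x : R := \tr (invmx (g x) *m ricci g x).

Definition hessian g f x : 'M[R]_N := \matrix_(i, j)
  (partial i (partial j f) x - \sum_k christoffel g k i j x * partial k f x).

Definition sqrt_det g x : R := Num.sqrt (\det (g x)).

Definition laplace_beltrami g f x : R :=
  (sqrt_det g x)^-1 *
  \sum_i partial i (fun y =>
    sqrt_det g y * \sum_j invmx (g y) i j * partial j f y) x.

Definition contraction g x (A B : 'M[R]_N) : R :=
  \sum_i \sum_j \sum_k \sum_l
    invmx (g x) i k * invmx (g x) j l * A i j * B k l.

Definition lichnerowicz g f x : R :=
  - 2^-1 * laplace_beltrami g (laplace_beltrami g f) x
  - contraction g x (ricci g x) (hessian g f x).

End Coordinates.

(* Iterated Lebesgue integral over R^N.  On nonnegative Borel functions, the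
   only ones it is used for, it is the integral against N-dimensional Lebesgue
   measure, by Tonelli's theorem. *)
Fixpoint lebesgue_iterated (R : realType) (N : nat) :
    ('rV[R]_N -> \bar R) -> \bar R :=
  match N with
  | 0 => fun F => F 0
  | N'.+1 => fun F => (\int[@lebesgue_measure R]_t
      lebesgue_iterated (fun y : 'rV[R]_N' =>
        F (row_mx (const_mx t : 'rV[R]_1) y)))%E
  end.

(* C^n is identified with R^(n + n), z_a = x_a + i x_(n + a).  The standard
   complex structure acts by u |-> u *m complexJ, so that it sends e_a to
   e_(n + a) and e_(n + a) to - e_a. *)
Definition complexJ (R : realType) (n : nat) : 'M[R]_(n + n) :=
  block_mx 0 1%:M (- 1%:M) 0.

(* The complex structure is given by a holomorphic atlas.  chart_inv is only
   relevant on the image of the chart; that image lies in R^(n + n). *)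
Record complex_manifold (R : realType) (n : nat) (M : ptopologicalType) :=
ComplexManifold {
  chart_index : Type;
  chart_dom : chart_index -> set M;
  chart : chart_index -> M -> 'rV[R]_(n + n);
  chart_inv : chart_index -> 'rV[R]_(n + n) -> M;
  manifold_hausdorff : hausdorff_space M;
  manifold_second_countable : @second_countable M;
  chart_cover : forall p, exists i, chart_dom i p;
  chart_dom_open : forall i, open (chart_dom i);
  chart_img_open : forall i, open (chart i @` chart_dom i);
  chartK : forall i p, chart_dom i p -> chart_inv i (chart i p) = p;
  chart_continuous : forall i p, chart_dom i p ->
    {for p, continuous (chart i)};
  chart_inv_continuous : forall i x, (chart i @` chart_dom i) x ->
    {for x, continuous (chart_inv i)};
  transition_smooth : forall i j k,
    smooth_on (chart i @` (chart_dom i `&` chart_dom j))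
      (fun x => chart j (chart_inv i x) 0 k);
  transition_holomorphic : forall i j x,
    (chart i @` (chart_dom i `&` chart_dom j)) x ->
    'J (chart j \o chart_inv i) x *m complexJ R n
    = complexJ R n *m 'J (chart j \o chart_inv i) x
}.

Definition chart_img (R : realType) (n : nat) (M : ptopologicalType)
    (X : complex_manifold R n M) (i : chart_index X) : set 'rV[R]_(n + n) :=
  chart i @` chart_dom i.

(* A Kaehler form: a closed real 2-form of type (1,1), i.e. invariant under the
   complex structure J, with omega(u, J u) > 0 for u != 0. *)
Record kaehler_form (R : realType) (n : nat) (M : ptopologicalType)
    (X : complex_manifold R n M) := KaehlerForm {
  form : chart_index X -> 'rV[R]_(n + n) -> 'M[R]_(n + n);
  form_smooth : forall i a b, smooth_on (chart_img i) (fun x => form i x a b);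
  form_transition : forall i j x,
    (chart i @` (chart_dom i `&` chart_dom j)) x ->
    form i x = 'J (chart j \o chart_inv i) x
               *m form j (chart j (chart_inv i x))
               *m ('J (chart j \o chart_inv i) x)^T;
  form_alternating : forall i x, chart_img i x -> (form i x)^T = - form i x;
  form_invariant : forall i x, chart_img i x ->
    complexJ R n *m form i x *m (complexJ R n)^T = form i x;
  form_positive : forall i x (u : 'rV[R]_(n + n)), chart_img i x -> u != 0 ->
    0 < (u *m form i x *m (u *m complexJ R n)^T) 0 0;
  form_closed : forall i x a b c, chart_img i x ->
    partial a (fun y => form i y b c) x + partial b (fun y => form i y c a) x
    + partial c (fun y => form i y a b) x = 0
}.

Definition borel (M : ptopologicalType) := g_sigma_algebraType (@open M).

Section Kaehler.
Context {R : realType} {n : nat} {M : ptopologicalType}.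
Context {X : complex_manifold R n M}.

(* g(u, v) = omega(u, J v) *)
Definition metric (w : kaehler_form X) (i : chart_index X)
    (x : 'rV[R]_(n + n)) : 'M[R]_(n + n) := form w i x *m (complexJ R n)^T.

Definition constant_scalar_curv (w : kaehler_form X) : Prop :=
  exists s : R, forall i x, chart_img i x -> scalar_curv (metric w i) x = s.

Definition smooth_fun (f : M -> R) : Prop :=
  forall i : chart_index X, smooth_on (chart_img i) (f \o chart_inv i).

Definition in_kernel (w : kaehler_form X) (f : M -> R) : Prop :=
  smooth_fun f /\ forall i x, chart_img i x ->
    lichnerowicz (metric w i) (f \o chart_inv i) x = 0.

(* The charts cover M, so this determines mu. *)
Definition riemannian_volume (w : kaehler_form X)
    (mu : {measure set (borel M) -> \bar R}) : Prop :=
  forall (i : chart_index X) (A : set (borel M)),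
    measurable A -> A `<=` chart_dom i ->
    mu A = lebesgue_iterated (fun x =>
      (\1_(chart i @` A) x * sqrt_det (metric w i) x)%:E).

Definition mean (mu : {measure set (borel M) -> \bar R}) (f : M -> R) : R :=
  (fine (mu setT))^-1 * \int[mu]_p f p.

Definition kernel_basis (w : kaehler_form X) (k : nat)
    (xi : 'I_k -> M -> R) : Prop :=
  [/\ forall i, in_kernel w (xi i),
      forall c : 'I_k -> R,
        (forall p, \sum_i c i * xi i p = 0) -> forall i, c i = 0
    & forall f, in_kernel w f ->
        exists c : 'I_k -> R, forall p, f p = \sum_i c i * xi i p].

End Kaehler.

(* Dimension of the linear span of S, as the maximal number of linearly
   independent vectors of S. *)
Definition span_dim (R : realType) (m : nat) (S : set 'cV[R]_m) : nat :=
  \max_(r < m.+1 | `[< exists2 A : 'M[R]_(m, r),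
      forall j, S (col j A) & \rank A = r >]) r.

Definition positive_cone (R : realType) (m : nat) : set 'cV[R]_m :=
  [set v | forall j, 0 < v j 0].

Section Points.
Context {R : realType} {M : Type} {d m : nat}.
Variables (xi : 'I_d.+1 -> M -> R) (p : 'I_m -> M).

(* xi ord0 is left out. *)
Definition eval_mx : 'M[R]_(d, m) := \matrix_(i, j) xi (lift ord0 i) (p j).

Definition C1 : nat := \rank eval_mx.

Definition C2 : nat :=
  span_dim (@positive_cone R m `&` [set v | eval_mx *m v = 0]).

End Points.

Definition balancing_points (R : realType) (M : ptopologicalType) (d m : nat)
    (xi : 'I_d.+1 -> M -> R) : set (prod_topology (fun _ : 'I_m => M)) :=
  [set p | C1 xi p = d /\ C2 xi p <> 0%N].

(* Main.v *)
Require Import Defs.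
From mathcomp Require Import measurable_realfun lra.

(** Write xi(p) for the vector (xi_1(p), ..., xi_d(p)) of R^d, so that the
    columns of the evaluation matrix A are xi(p_1), ..., xi(p_m).

    Openness.  The functions in the kernel are continuous, hence so are the
    entries of A.  If A has rank d at a point, it has there a right inverse B,
    and A B stays invertible nearby; correcting a given positive kernel vector
    v by B (A B)^-1 A v gives a kernel vector that depends continuously on the
    points and equals v at the start, so it remains positive
    ([open_full_rank_positive_kernel]).

    Nonemptiness.  Let c be a nonzero vector of R^d and f = sum_i c_i xi_i.
    Then f is not zero, as the xi_i are linearly independent, and its integral
    is 0.  The Riemannian measure is finite on the compact M and charges every
    nonempty open set, so a continuous f of integral 0 that is nowhere positive
    vanishes; hence f takes a positive value ([mean_zero_positive_value]).  By
    compactness of the unit sphere of R^d, finitely many points p_1, ..., p_m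
    suffice to witness this for all c ([finite_positive_points]), and adding
    further points does no harm.  For such points no nonzero c satisfies
    c A = 0, so A has rank d.  Moreover the function
      F(c) = sum_j exp (c . xi(p_j))
    is coercive, so it has a minimum c0; the gradient of F vanishes there, which
    says precisely that the positive vector with entries exp (c0 . xi(p_j)) is
    in the kernel of A ([positive_kernel_vector]).

    The measure of a set inside a chart is an iterated Lebesgue integral of the
    density sqrt (det g).  The density is continuous and positive, hence
    pinched between two positive constants near each point; comparing with the
    explicit value of the iterated integral on cubes ([lebesgue_iterated_ball])
    shows that the measure is positive on open sets and locally finite. *)

(** * Matrices depending on a parameter *)

Section RealMatrices.
Context {R : realType}.

Lemma cvg_det {T : Type} (F : set_system T) {FF : Filter F} {N : nat}
    (A : T -> 'M[R]_N) (a : 'M[R]_N) :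
  (forall i j, A s i j @[s --> F] --> a i j) ->
  \det (A s) @[s --> F] --> \det a.
Proof.
move=> cA; rewrite /determinant.
apply: (@cvg_big _ _ +%R) => [|s _]; first exact: add_continuous.
apply: cvgMr.
apply: (@cvg_big R _ *%R 1) => [|i _]; first exact: mul_continuous.
exact: cA.
Qed.

Lemma cvg_mulmx {T : Type} (F : set_system T) {FF : Filter F} {m n p : nat}
    (A : T -> 'M[R]_(m, n)) (B : T -> 'M[R]_(n, p))
    (a : 'M[R]_(m, n)) (b : 'M[R]_(n, p)) :
  (forall i j, A s i j @[s --> F] --> a i j) ->
  (forall i j, B s i j @[s --> F] --> b i j) ->
  forall i j, (A s *m B s) i j @[s --> F] --> (a *m b) i j.
Proof.
move=> cA cB i j; rewrite mxE; under eq_fun do rewrite mxE.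
apply: (@cvg_big _ _ +%R) => [|k _]; first exact: add_continuous.
by apply: cvgM; [exact: cA | exact: cB].
Qed.

Lemma cvg_adjugate {T : Type} (F : set_system T) {FF : Filter F} {N : nat}
    (A : T -> 'M[R]_N) (a : 'M[R]_N) :
  (forall i j, A s i j @[s --> F] --> a i j) ->
  forall i j, (\adj (A s)) i j @[s --> F] --> (\adj a) i j.
Proof.
move=> cA i j; rewrite mxE; under eq_fun do rewrite mxE.
apply: cvgMr; apply: cvg_det => k l.
have minorE (C : 'M[R]_N) : row' j (col' i C) k l = C (lift j k) (lift i l).
  by rewrite 2!mxE.
by rewrite minorE; under eq_fun do rewrite minorE; exact: cA.
Qed.

(** The determinant of t G + (1 - t) I does not vanish for t in [0, 1], because
    this matrix is again positive definite, and it is 1 at t = 0. *)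
Lemma det_gt0_posdef {N : nat} (G : 'M[R]_N) :
  (forall u : 'rV[R]_N, u != 0 -> 0 < (u *m G *m u^T) 0 0) -> 0 < \det G.
Proof.
move=> Gpos.
pose q (t : R) : R := \det (t *: G + (1 - t)%:M).
have sq (u : 'rV[R]_N) : u != 0 -> 0 < (u *m u^T) 0 0.
  move=> u0; rewrite mxE lt_neqAle eq_sym; apply/andP; split; last first.
    by apply: sumr_ge0 => i _; rewrite mxE -expr2 sqr_ge0.
  apply: contra u0 => /eqP /psumr_eq0P u0; apply/eqP/rowP => i.
  have /eqP : u 0 i * u^T i 0 = 0.
    by apply: u0 => // k _; rewrite mxE -expr2 sqr_ge0.
  by rewrite !mxE mulf_eq0 orbb => /eqP.
have q0 t : 0 <= t <= 1 -> q t != 0.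
  move=> /andP[t0 t1]; apply/negP => /det0P[u u0 /(congr1 (mulmx^~ u^T))].
  rewrite mulmxDr -scalemxAr mul_mx_scalar mul0mx mulmxDl -!scalemxAl.
  move=> /matrixP/(_ 0 0); rewrite [RHS]mxE [LHS]mxE [X in _ + X]mxE.
  rewrite [X in X + _]mxE; have := Gpos _ u0; have := sq _ u0.
  by case: (ltrgt0P t) t0 => // [?|->] _; nra.
have cq : continuous q.
  move=> t; apply: cvg_det => i j; under eq_fun do rewrite !mxE.
  rewrite !mxE; apply: cvgD; first by apply: cvgMl; exact: cvg_id.
  by apply: cvgMn; apply: cvgB; [exact: cvg_cst | exact: cvg_id].
have q00 : q 0 = 1 by rewrite /q scale0r add0r subr0 det1.
have <- : q 1 = \det G by rewrite /q scale1r subrr raddf0 addr0.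
rewrite ltNge; apply/negP => q1.
have [|t] := @IVT R q 0 1 0 ler01 (continuous_subspaceT cq).
  by rewrite q00 minEle maxEle; case: ifP; lra.
by rewrite in_itv => /q0/[swap] ->; rewrite eqxx.
Qed.

(** The vector v - B (A B)^-1 A v is in the kernel of A whenever A B is
    invertible.  Below it is multiplied by det (A B), so that its entries are
    polynomial in those of A. *)
Lemma open_full_rank_positive_kernel {T : topologicalType} {d m : nat}
    (A : T -> 'M[R]_(d, m)) :
  (forall i j, continuous (fun t => A t i j)) ->
  open [set t | \rank (A t) = d /\
                exists2 v, positive_cone v & A t *m v = 0].
Proof.
move=> cA; rewrite openE => t [rkA [v v_gt0 Av0]].
have /mulmxVp : row_free (A t) by rewrite /row_free rkA.
move: (pinvmx (A t)) => B AB1.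
pose D s := \det (A s *m B).
pose u s : 'cV[R]_m := D s *: v - B *m \adj (A s *m B) *m A s *m v.
have cAB i j : (A s *m B) i j @[s --> t] --> (A t *m B) i j.
  by apply: cvg_mulmx => k l; [exact: cA | exact: cvg_cst].
have cD : D s @[s --> t] --> D t by exact: cvg_det.
have cu j : u s j 0 @[s --> t] --> u t j 0.
  have uE s : u s j 0 = D s * v j 0 - (B *m \adj (A s *m B) *m A s *m v) j 0.
    by rewrite /u; move: (_ *m v) => x; rewrite !mxE.
  rewrite uE; under eq_fun do rewrite uE.
  apply: cvgB; first by apply: cvgMl; exact: cD.
  apply: cvg_mulmx => k l; last exact: cvg_cst.
  apply: cvg_mulmx => {k l} k l; last exact: cA.
  by apply: cvg_mulmx => {k l} k l; [exact: cvg_cst | exact: cvg_adjugate].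
have Dt : D t = 1 by rewrite /D AB1 det1.
have ut : u t = v by rewrite /u Dt scale1r -mulmxA Av0 mulmx0 subr0.
have nearD : \forall s \near t, 0 < D s.
  by apply: (cvgr_gt (D t) cD); rewrite Dt.
have nearu : \forall s \near t, forall j, 0 < u s j 0.
  apply: filter_forall => j; apply: (cvgr_gt (u t j 0) (cu j)).
  by rewrite ut; exact: v_gt0.
near=> s; split.
  apply/eqP; rewrite eqn_leq rank_leq_row /=.
  rewrite -{1}(@mxrank_unit _ d (A s *m B)) ?mxrankM_maxl //.
  by rewrite unitmxE unitfE gt_eqF //; near: s.
have us : forall j, 0 < u s j 0 by near: s.
exists (u s); first exact: us.
rewrite /u mulmxBr -scalemxAr !mulmxA mul_mx_adj mul_scalar_mx.
by rewrite -scalemxAl subrr.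
Unshelve. all: by end_near. Qed.

(** * Positive kernel vectors and positive linear forms *)

Lemma closed_sphere {V : normedModType R} : closed [set c : V | `|c| = 1].
Proof.
apply: (@closed_comp _ _ (fun c : V => `|c|) [set 1]); last exact: closed_eq.
by move=> c _; exact: norm_continuous.
Qed.

Lemma compact_sphere {d : nat} : compact [set c : 'rV[R]_d | `|c| = 1].
Proof.
apply: bounded_closed_compact; last exact: closed_sphere.
by exists 1; split => // r r1 c /= ->; exact: ltW.
Qed.

Lemma continuous_mulmx_coord {d m : nat} (A : 'M[R]_(d, m)) (j : 'I_m) :
  continuous (fun c : 'rV[R]_d => (c *m A) 0 j).
Proof.
move=> c; apply: (@cvg_mulmx _ (nbhs c)) => k l; last exact: cvg_cst.
exact: coord_continuous.
Qed.

(** The nontrivial direction of Stiemke's theorem of the alternative: the vector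
    v is read off from the vanishing gradient of c |-> sum_j exp ((c A)_j) at a
    minimum. *)
Lemma positive_kernel_vector {d m : nat} (A : 'M[R]_(d, m)) :
  (forall c : 'rV[R]_d, c != 0 -> exists j, 0 < (c *m A) 0 j) ->
  exists2 v, positive_cone v & A *m v = 0.
Proof.
(* For d = 0 the unit sphere used below is empty. *)
case: d A => [|d] A posA.
  by exists (const_mx 1) => [j|]; rewrite ?mxE ?ltr01 //; exact: flatmx0.
(* G is twice the sum of the positive parts of the (c A)_j.  It is homogeneous,
   so its minimum on the sphere gives a linear lower bound for F. *)
pose F (c : 'rV[R]_d.+1) := \sum_j expR ((c *m A) 0 j).
pose G (c : 'rV[R]_d.+1) : R := \sum_j (`|(c *m A) 0 j| + (c *m A) 0 j).
have cF : continuous F.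
  apply: continuous_big => [|j _]; first exact: add_continuous.
  move=> c; apply: continuous_comp; first exact: continuous_mulmx_coord.
  exact: continuous_expR.
have cG : continuous G.
  apply: continuous_big => [|j _]; first exact: add_continuous.
  move=> c; have cc := @continuous_mulmx_coord _ _ A j c.
  apply: (@cvgD _ _ _ (nbhs c)); last exact: cc.
  exact: (@cvg_norm _ _ _ (nbhs c)).
have term_ge0 (x : R) : 0 <= `|x| + x.
  by rewrite -lerBlDr sub0r -normrN ler_norm.
have GZ t c : 0 <= t -> G (t *: c) = t * G c.
  move=> t0; rewrite /G mulr_sumr; apply: eq_bigr => j _.
  by rewrite -scalemxAl mxE normrM ger0_norm // mulrDr.
have GF c : G c <= 2 * F c.
  rewrite /F mulr_sumr; apply: ler_sum => j _.
  have := expR_ge0 ((c *m A) 0 j); have := expR_ge1Dx ((c *m A) 0 j).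
  by case: (ler0P ((c *m A) 0 j)); lra.
have G_ge0 c : 0 <= G c by apply: sumr_ge0 => j _; exact: term_ge0.
have Gpos c : c != 0 -> 0 < G c.
  move=> /posA[j cj]; rewrite /G (bigD1 j) //= ltr_wpDr //.
    by apply: sumr_ge0 => k _; exact: term_ge0.
  by rewrite addr_gt0 // normr_gt0 gt_eqF.
have [|c1 c1S Gc1] := compact_EVT_min _ (@compact_sphere d.+1)
    (continuous_subspaceT cG).
  exists (`|const_mx 1 : 'rV[R]_d.+1|^-1 *: const_mx 1); apply: normfZV.
  by apply/eqP => /rowP/(_ 0); rewrite !mxE => /eqP; rewrite oner_eq0.
have e_gt0 : 0 < G c1.
  apply: Gpos; move: c1S; rewrite inE /= => c1S; apply/eqP => c10.
  by move: c1S; rewrite c10 normr0 => /eqP; rewrite eq_sym oner_eq0.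
set e := G c1 in e_gt0.
have coercive c : e * `|c| <= 2 * F c.
  apply: le_trans (GF c); have [->|c0] := eqVneq c 0.
    by rewrite normr0 mulr0.
  have n0 : 0 < `|c| by rewrite normr_gt0.
  rewrite mulrC -ler_pdivlMl // -GZ ?invr_ge0 ?normr_ge0 //.
  by apply: Gc1; rewrite inE /=; exact: normfZV.
(* Outside the ball of radius r, F exceeds its value at 0. *)
pose r := 2 * F 0 / e.
have r_ge0 : 0 <= r.
  by rewrite divr_ge0 ?(ltW e_gt0) ?(le_trans (G_ge0 0)).
have cball : compact [set c : 'rV[R]_d.+1 | `|c| <= r].
  apply: bounded_closed_compact.
    exists r; split => [|s rs c /= cr]; first exact: num_real.
    by rewrite (le_trans cr) ?ltW.
  apply: (@closed_comp _ _ (fun c : 'rV[R]_d.+1 => `|c|) [set x | x <= r]).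
    by move=> c _; exact: norm_continuous.
  exact: closed_le.
have [|c0 c0r Fc0] := compact_EVT_min _ cball (continuous_subspaceT cF).
  by exists 0; rewrite /= normr0.
have Fmin c : F c0 <= F c.
  have [cr|cr] := leP `|c| r; first by apply: Fc0; rewrite inE.
  apply: (@le_trans _ _ (F 0)); first by apply: Fc0; rewrite inE /= normr0.
  rewrite -(ler_pM2l (ltr0n R 2)); apply: le_trans (coercive c); move: cr.
  by rewrite ltr_pdivrMr // (mulrC `|c|) => /ltW.
exists (\col_j expR ((c0 *m A) 0 j)) => [j|]; first by rewrite mxE expR_gt0.
apply/colP => i; rewrite [LHS]mxE [RHS]mxE.
(* The i-th partial derivative of F at c0 is (A v)_i. *)
pose phi (t : R) : R := \sum_j expR ((c0 *m A) 0 j + t * A i j).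
have phiE t : phi t = F (c0 + t *: delta_mx 0 i).
  apply: eq_bigr => j _; congr expR.
  by rewrite mulmxDl -scalemxAl -rowE !mxE.
have dphi (t : R) : is_derive t (1 : R) phi
    (\sum_j A i j * expR ((c0 *m A) 0 j + t * A i j)).
  have -> : phi = \sum_j (expR \o (fun t => (c0 *m A) 0 j + t * A i j)).
    by apply/funext => x; rewrite fct_sumE.
  apply: is_derive_sum => j; rewrite mulrC.
  have lin : is_derive t (1 : R)
      (fun t : R => (c0 *m A) 0 j + t * A i j) (A i j).
    have -> : (fun t : R => (c0 *m A) 0 j + t * A i j) =
        cst ((c0 *m A) 0 j) + (id : R -> R) * cst (A i j) by [].
    apply: is_derive_eq; rewrite add0r scaler0 add0r.
    exact: mulr1.
  exact: is_derive1_comp.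
have phi0 : is_derive (0 : R) (1 : R) phi 0.
  apply: (@derive1_at_min _ phi (-1) 1) => [|t _||t _].
  - lra.
  - by case: (dphi t).
  - by rewrite in_itv /= ltrN10 ltr01.
  - by rewrite !phiE scale0r addr0.
have := @derive_val _ _ _ _ _ _ _ phi0.
rewrite (@derive_val _ _ _ _ _ _ _ (dphi 0)) => grad0.
by rewrite -[RHS]grad0; apply: eq_bigr => j _; rewrite !mxE mul0r addr0.
Qed.

(** For each p the c with a positive sum form an open set, and the unit sphere
    is covered by finitely many of them; the condition is invariant under
    scaling of c. *)
Lemma finite_positive_points {M : choiceType} {d : nat} (f : 'I_d -> M -> R) :
  (forall c : 'rV[R]_d, c != 0 -> exists p, 0 < \sum_i c 0 i * f i p) ->
  exists s : seq M, forall c : 'rV[R]_d, c != 0 ->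
    exists2 p, p \in s & 0 < \sum_i c 0 i * f i p.
Proof.
move=> fpos.
pose U p := [set c : 'rV[R]_d | 0 < \sum_i c 0 i * f i p].
have Uopen p : open (U p).
  apply: (@open_comp _ _ (fun c : 'rV[R]_d => \sum_i c 0 i * f i p)
    [set x | 0 < x]); last exact: open_gt.
  move=> + _; apply: continuous_big => [|i _ c]; first exact: add_continuous.
  by apply: (@cvgMl _ _ (nbhs c)); exact: coord_continuous.
have := @compact_sphere d; rewrite compact_cover.
move=> /(_ M setT U (fun p _ => Uopen p)) [c c1|s _ sU].
  have [|p cp] := fpos c; last by exists p.
  by rewrite -normr_gt0 c1 ltr01.
exists (finmap.enum_fset s) => c c0.
have [p ps /= cp] := sU (`|c|^-1 *: c) (normfZV c0).
exists p => //; move: cp; rewrite /U /=.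
have -> : \sum_i (`|c|^-1 *: c) 0 i * f i p = `|c|^-1 * \sum_i c 0 i * f i p.
  by rewrite mulr_sumr; apply: eq_bigr => i _; rewrite mxE mulrA.
by rewrite pmulr_rgt0 // invr_gt0 normr_gt0.
Qed.

(** * Comparison for the iterated Lebesgue integral *)

(** The integral of a nonnegative function is a supremum over the simple
    functions below it, so it is monotone without any measurability: the
    partial integrals in [lebesgue_iterated] are then compared with no need to
    know that they are measurable. *)
Lemma le_integral_ge0 d (T : measurableType d)
    (mu : {measure set T -> \bar R}) (f g : T -> \bar R) :
  (forall x, 0 <= f x)%E -> (forall x, f x <= g x)%E ->
  (\int[mu]_x f x <= \int[mu]_x g x)%E.
Proof.
move=> f0 fg; have g0 x : (0 <= g x)%E by exact: le_trans (fg x).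
rewrite !ge0_integralTE //; apply: ereal_sup_le => _ [h hf <-].
by exists h => // x; exact: le_trans (fg x).
Qed.

Lemma lebesgue_iterated_ge0 (N : nat) (F : 'rV[R]_N -> \bar R) :
  (forall x, 0 <= F x)%E -> (0 <= lebesgue_iterated F)%E.
Proof.
by elim: N F => //= N IH F F0; apply: integral_ge0 => t _; exact: IH.
Qed.

Lemma le_lebesgue_iterated (N : nat) (F G : 'rV[R]_N -> \bar R) :
  (forall x, 0 <= F x)%E -> (forall x, F x <= G x)%E ->
  (lebesgue_iterated F <= lebesgue_iterated G)%E.
Proof.
elim: N F G => //= N IH F G F0 FG.
apply: le_integral_ge0 => t; first exact: lebesgue_iterated_ge0.
exact: IH.
Qed.

Lemma ball_row_mx (N : nat) (a : 'rV[R]_(1 + N)) (e t : R) (y : 'rV[R]_N) :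
  ball a e (row_mx (const_mx t : 'rV[R]_1) y) <->
  ball (a 0 (lshift N 0)) e t /\ ball (rsubmx a) e y.
Proof.
split=> [[e0 aB]|[tB [e0 yB]]].
  split; first by have := aB 0 (lshift N 0); rewrite row_mxEl mxE.
  by split => // i j; have := aB i (rshift 1 j); rewrite row_mxEr mxE.
split=> // i j; rewrite (ord1 i); case: (split_ordP j) => k ->.
  by rewrite (ord1 k) row_mxEl mxE.
by have := yB 0 k; rewrite row_mxEr mxE.
Qed.

Lemma indic_ball_row_mx (N : nat) (a : 'rV[R]_(1 + N)) (e t : R)
    (y : 'rV[R]_N) :
  \1_(ball a e) (row_mx (const_mx t : 'rV[R]_1) y) =
  \1_(ball (a 0 (lshift N 0)) e) t * \1_(ball (rsubmx a) e) y :> R.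
Proof.
rewrite !indicE -natrM mulnb; congr ((nat_of_bool _)%:R).
apply/idP/andP; first by rewrite !inE => /ball_row_mx.
by rewrite !inE => ?; exact/ball_row_mx.
Qed.

(** Balls of row vectors are cubes, since they are the balls of the sup norm. *)
Lemma lebesgue_iterated_ball (N : nat) (a : 'rV[R]_N) (e c : R) :
  0 < e -> 0 <= c ->
  lebesgue_iterated (fun x => (c * \1_(ball a e) x)%:E) =
  (c * (e *+ 2) ^+ N)%:E.
Proof.
move=> e0; elim: N a c => [|N IH] a c c0 /=.
  by rewrite (thinmx0 a) indicE mem_set ?expr0 //; exact: ballxx.
transitivity (\int[@lebesgue_measure R]_t
    ((c * (e *+ 2) ^+ N)%:E *
     (\1_(ball (a 0 (lshift N (0 : 'I_1))) e) t)%:E))%E.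
  apply: eq_integral => t _; rewrite -EFinM mulrAC.
  rewrite -(IH (@rsubmx _ 1 1 N a)); last first.
    by rewrite mulr_ge0 // indicE.
  congr lebesgue_iterated; apply/funext => y; congr EFin.
  by rewrite -mulrA; congr (_ * _); exact: indic_ball_row_mx.
rewrite ge0_integralZl_EFin //; first last.
- by rewrite mulr_ge0 // exprn_ge0 // mulrn_wge0 // ltW.
- by apply/measurable_EFinP; apply: measurable_indic; exact: measurable_ball.
rewrite integral_indic //; last exact: measurable_ball.
have ballE :
    lebesgue_measure (ball (a 0 (lshift N (0 : 'I_1))) e) = (e *+ 2)%:E.
  by apply: lebesgue_measure_ball; exact: ltW.
by rewrite setIT [X in (_ * X)%E]ballE exprSr mulrA EFinM.
Qed.

(** * Borel measures on a compact space *)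

Lemma measurable_borel {M : ptopologicalType} (U : set (borel M)) :
  @open M U -> measurable U.
Proof. by move=> oU; apply: sub_sigma_algebra. Qed.

Lemma measurable_fun_borel {M : ptopologicalType} (f : M -> R) :
  continuous f -> measurable_fun [set: borel M] (f : borel M -> R).
Proof.
move=> cf mT; apply: (measurability _ (RGenOInfty.measurableE R)) => //.
move=> _ [_ [a ->] <-]; rewrite setTI; apply: measurable_borel.
by apply: open_comp => // p _; exact: cf.
Qed.

Lemma integrable_continuous {M : ptopologicalType}
    (mu : {measure set (borel M) -> \bar R}) (f : M -> R) :
  compact [set: M] -> (mu setT < +oo)%E -> continuous f ->
  mu.-integrable [set: borel M] (EFin \o f).
Proof.
move=> cM mu_fin cf; apply: measurable_bounded_integrable => //.
  exact: measurable_fun_borel.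
have /compact_bounded[N [Nr Nf]] :=
  continuous_compact (continuous_subspaceT cf) cM.
by exists N; split => // x Nx p _; apply: Nf => //; exists p.
Qed.

(** If f p > 0, then f > f p / 2 on an open neighbourhood of p, whose measure is
    positive. *)
Lemma Rintegral_eq0_continuous {M : ptopologicalType}
    (mu : {measure set (borel M) -> \bar R}) (f : M -> R) :
  compact [set: M] -> (mu setT < +oo)%E ->
  (forall U : set M, open U -> U !=set0 -> (0 < mu U)%E) ->
  continuous f -> (forall p, 0 <= f p) -> \int[mu]_p f p = 0 ->
  forall p, f p = 0.
Proof.
move=> cM mu_fin mu_pos cf f0 intf p; apply/eqP/negPn/negP => fp.
have {}fp : 0 < f p by rewrite lt_neqAle eq_sym fp f0.
pose U : set M := [set q | f p / 2 < f q].
have oU : open U.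
  apply: (@open_comp _ _ f [set x | f p / 2 < x]); last exact: open_gt.
  by move=> q _; exact: cf.
have mU : @measurable _ (borel M) U by exact: measurable_borel.
have : (0 < mu U)%E by apply: mu_pos => //; exists p; rewrite /U /=; lra.
apply/negP; rewrite -leNgt -(@pmule_rle0 _ (f p / 2)%:E) ?lte_fin ?divr_gt0 //.
have <- : (\int[mu]_q (f q)%:E = 0)%E.
  move: intf; rewrite /Rintegral => /eqP; rewrite fine_eq0; last first.
    by apply: integrable_fin_num => //; exact: integrable_continuous.
  by move=> /eqP.
have <- : (\int[mu]_q ((f p / 2)%:E * (\1_U q)%:E) = (f p / 2)%:E * mu U)%E.
  rewrite ge0_integralZl_EFin //; last by rewrite divr_ge0.
    by rewrite integral_indic // setIT.
  by apply/measurable_EFinP; exact: measurable_indic.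
apply: le_integral_ge0 => q.
  by rewrite -EFinM lee_fin indicE mulr_ge0 // divr_ge0.
rewrite -EFinM lee_fin indicE; have [|_] := boolP (q \in U).
  by rewrite inE mulr1 => /ltW.
by rewrite mulr0.
Qed.

End RealMatrices.

(** * The Riemannian volume *)

Section Volume.
Context {R : realType} {n : nat} {M : ptopologicalType}.
Context {X : complex_manifold R n M} (w : kaehler_form X).

(** Positivity of the Kaehler form says that the matrix of the metric is
    positive definite. *)
Lemma det_metric_gt0 (i : chart_index X) (x : 'rV[R]_(n + n)) :
  chart_img i x -> 0 < \det (metric w i x).
Proof.
move=> ix; apply: det_gt0_posdef => u u0.
by have := form_positive w ix u0; rewrite /metric trmx_mul !mulmxA.
Qed.

Lemma cvg_sqrt_det (i : chart_index X) (x : 'rV[R]_(n + n)) :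
  chart_img i x ->
  sqrt_det (metric w i) y @[y --> x] --> sqrt_det (metric w i) x.
Proof.
move=> ix.
apply: (@cvg_comp _ _ _ _ Num.sqrt _ (nbhs (\det (metric w i x)))).
  apply: (@cvg_det _ _ (nbhs x)) => a b.
  apply: (@cvg_mulmx _ _ (nbhs x)) => k l; last exact: cvg_cst.
  by have [+ _] := form_smooth w i k l 0; apply.
exact: sqrt_continuous.
Qed.

Lemma chart_invK (i : chart_index X) (x : 'rV[R]_(n + n)) :
  chart_img i x -> chart i (chart_inv i x) = x.
Proof. by move=> [q qi <-]; rewrite chartK. Qed.

Context (mu : {measure set (borel M) -> \bar R}).
Context (mu_vol : riemannian_volume w mu).

(** In a chart, U contains a cube on which the density exceeds half its value at
    the centre. *)
Lemma riemannian_volume_gt0 (U : set M) : open U -> U !=set0 -> (0 < mu U)%E.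
Proof.
move=> oU [p Up]; have [i ip] := chart_cover X p.
pose A : set M := U `&` chart_dom i.
have oA : open A by apply: openI => //; exact: chart_dom_open.
have mA : @measurable _ (borel M) A by exact: measurable_borel.
have mU : @measurable _ (borel M) U by exact: measurable_borel.
apply: (@lt_le_trans _ _ (mu A)); last first.
  by apply: le_measure; rewrite ?inE //; exact: subIsetl.
pose x := chart i p.
have ix : chart_img i x by exists p.
have xA : A (chart_inv i x) by rewrite chartK.
pose c := sqrt_det (metric w i) x.
have c0 : 0 < c by rewrite sqrtr_gt0 det_metric_gt0.
have near_gt : \forall y \near x, c / 2 < sqrt_det (metric w i) y.
  by have /cvgr_gt := cvg_sqrt_det _ _ ix; apply; rewrite -/c; lra.
have : \forall y \near x, [/\ chart_img i y, A (chart_inv i y) &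
    c / 2 < sqrt_det (metric w i) y].
  near=> y; split; near: y.
  - by apply: open_nbhs_nbhs; split => //; exact: chart_img_open.
  - apply: (chart_inv_continuous ix); exact: open_nbhs_nbhs.
  - exact: near_gt.
move=> /nbhs_ballP[e /= e0 Be].
rewrite (mu_vol i _ mA); last exact: subIsetr.
apply: (@lt_le_trans _ _
    (lebesgue_iterated (fun y => (c / 2 * \1_(ball x e) y)%:E))).
  rewrite lebesgue_iterated_ball ?divr_ge0 ?ltW // lte_fin.
  by rewrite mulr_gt0 ?divr_gt0 // exprn_gt0 // mulrn_wgt0.
apply: le_lebesgue_iterated => y.
  by rewrite lee_fin indicE mulr_ge0 // divr_ge0 // ltW.
rewrite lee_fin !indicE.
have [|_] := boolP (y \in (ball x e : set 'rV[R]_(n + n))); last first.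
  by rewrite mulr0 mulr_ge0 // sqrtr_ge0.
rewrite inE => /Be[iy Ay cy]; rewrite mem_set ?mulr1 ?mul1r ?ltW //.
by exists (chart_inv i y) => //; exact: chart_invK.
Unshelve. all: by end_near. Qed.

(** A whole chart may have infinite volume; a cube on which the density is
    bounded has not. *)
Lemma riemannian_volume_locally_finite (p : M) :
  exists U : set M, [/\ open U, U p & (mu U < +oo)%E].
Proof.
have [i ip] := chart_cover X p.
pose x := chart i p.
have ix : chart_img i x by exists p.
pose c := sqrt_det (metric w i) x + 1.
have c0 : 0 <= c by rewrite addr_ge0 // sqrtr_ge0.
have : \forall y \near x, sqrt_det (metric w i) y < c.
  by have /cvgr_lt := cvg_sqrt_det _ _ ix; apply; rewrite ltrDl.
move=> /nbhs_ballP[e /= e0 Be].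
(* The interior is taken because [mu_vol] asks for a measurable set. *)
pose U := (chart_dom i `&` chart i @^-1` ball x e)°.
have Up : U p.
  apply: filterI.
    by apply: open_nbhs_nbhs; split => //; exact: chart_dom_open.
  by apply: (chart_continuous ip); exact: nbhsx_ballx.
have oU : open U by exact: open_interior.
have Usub : U `<=` chart_dom i `&` chart i @^-1` ball x e.
  exact: interior_subset.
exists U; split => //.
rewrite (mu_vol i _ (measurable_borel _ oU)); last by move=> q /Usub[].
apply: (@le_lt_trans _ _
    (lebesgue_iterated (fun y => (c * \1_(ball x e) y)%:E))).
  apply: le_lebesgue_iterated => y.
    by rewrite lee_fin indicE mulr_ge0 // sqrtr_ge0.
  rewrite lee_fin !indicE; have [|_] := boolP (y \in chart i @` U); last first.
    by rewrite mul0r mulr_ge0.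
  rewrite inE => -[q /Usub[_ qB] <-]; rewrite mem_set // mul1r mulr1 ltW //.
  exact: Be.
by rewrite lebesgue_iterated_ball // ltry.
Qed.

Lemma riemannian_volume_finite : compact [set: M] -> (mu setT < +oo)%E.
Proof.
have [U UP] := choice riemannian_volume_locally_finite.
rewrite compact_cover => /(_ M setT U) [p _|p _|s _ sU].
- by have [] := UP p.
- by exists p => //; have [] := UP p.
have mUU q : @measurable _ (borel M) (U q).
  by apply: measurable_borel; have [] := UP q.
pose V : set (borel M) := \big[setU/set0]_(q <- finmap.enum_fset s) U q.
have -> : [set: borel M] = V.
  apply/seteqP; split=> // q _; have [r rs Urq] := sU q I.
  by rewrite /V -bigcup_seq; exists r.
rewrite /V; elim: (finmap.enum_fset s) => [|q r IH].
  by rewrite big_nil measure0.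
rewrite big_cons; apply: le_lt_trans (measureU2 _ _ _) _ => //.
  exact: bigsetU_measurable.
by rewrite lte_add_pinfty //; have [] := UP q.
Qed.

End Volume.

(** * Balancing points *)

(** A single positive vector spans a line.  With no point at all this would
    fail: the only vector of R^0 is positive but spans nothing. *)
Lemma C2_neq0P {R : realType} {M : Type} {d m : nat} (xi : 'I_d.+1 -> M -> R)
    (p : 'I_m.+1 -> M) :
  C2 xi p <> 0%N <-> exists2 v, positive_cone v & eval_mx xi p *m v = 0.
Proof.
rewrite /C2 /span_dim; set S := _ `&` _; split=> [/eqP|[v v_gt0 Av0]].
  rewrite -lt0n => S_gt0; apply: contrapT => noS; move: S_gt0.
  rewrite ltnNge => /negP; apply.
  apply/bigmax_leqP => -[[//|r] rm] /asboolP[A SA _].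
  by have [cone ker] := SA 0; case: noS; exists (col 0 A).
apply/eqP; rewrite -lt0n.
have -> : 1%N = (inord 1 : 'I_m.+2) by rewrite inordK.
apply: leq_bigmax_cond; apply/asboolP; rewrite inordK //.
exists v => [j|].
  by rewrite (_ : col j v = v) //; apply/colP => i; rewrite mxE (ord1 j).
have: v != 0.
  by apply/eqP => v0; have := v_gt0 0; rewrite v0 mxE ltxx.
by rewrite -mxrank_eq0; have := rank_leq_col v; case: (\rank v) => [|[]].
Qed.

Lemma kernel_continuous {R : realType} {n : nat} {M : ptopologicalType}
    {X : complex_manifold R n M} (w : kaehler_form X) (f : M -> R) :
  in_kernel w f -> continuous f.
Proof.
move=> [f_smooth _] p; have [i ip] := chart_cover X p.
have [cf _] := f_smooth i 0%N.
have ix : chart_img i (chart i p) by exists p.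
have cfi :
    ((f \o chart_inv i) \o chart i) @ p --> (f \o chart_inv i) (chart i p).
  apply: (cvg_comp (chart i) (f \o chart_inv i)); last exact: (cf _ ix).
  exact: chart_continuous.
rewrite /= chartK // in cfi; apply: cvg_trans cfi; apply: near_eq_cvg.
have : \forall q \near p, chart_dom i q.
  by apply: open_nbhs_nbhs; split => //; exact: chart_dom_open.
by apply: filterS => q iq /=; rewrite chartK.
Qed.

(** Otherwise - sum_i c_i f_i is nonnegative and continuous with integral 0, so
    it vanishes, against linear independence. *)
Lemma mean_zero_positive_value {R : realType} {M : ptopologicalType} {d : nat}
    (mu : {measure set (borel M) -> \bar R}) (f : 'I_d -> M -> R) :
  compact [set: M] -> (mu setT < +oo)%E ->
  (forall U : set M, open U -> U !=set0 -> (0 < mu U)%E) ->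
  (forall i, continuous (f i)) -> (forall i, \int[mu]_p f i p = 0) ->
  (forall c : 'rV[R]_d, (forall p, \sum_i c 0 i * f i p = 0) -> c = 0) ->
  forall c : 'rV[R]_d, c != 0 -> exists p, 0 < \sum_i c 0 i * f i p.
Proof.
move=> cM mu_fin mu_pos cf f0 free c c0; apply: contrapT => noP.
case/negP: c0; rewrite -oppr_eq0; apply/eqP/free.
have cont (r : seq 'I_d) :
    continuous (fun p => \sum_(i <- r) (- c) 0 i * f i p).
  apply: continuous_big => [|i _ p]; first exact: add_continuous.
  by apply: cvgMr; exact: cf.
apply: (Rintegral_eq0_continuous mu) => // [p|].
- rewrite leNgt; apply/negP => gp; apply: noP; exists p; move: gp.
  by rewrite -oppr_gt0 -sumrN; under eq_bigr do rewrite mxE mulNr opprK.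
- elim: (index_enum _) => [|i r IH].
    by under eq_Rintegral do rewrite big_nil; rewrite Rintegral_cst ?mul0r.
  under eq_Rintegral do rewrite big_cons.
  have int g : continuous g -> mu.-integrable [set: borel M] (EFin \o g).
    exact: integrable_continuous.
  rewrite RintegralD //; [|apply: int|apply: int; exact: cont]; last first.
    by move=> p; apply: cvgMr; exact: cf.
  by rewrite IH addr0 RintegralZl ?f0 ?mulr0 //; apply: int; exact: cf.
Qed.

Theorem lemma1p2 (R : realType) (n : nat) (M : ptopologicalType)
  (X : complex_manifold R n M) (w : kaehler_form X)
  (M_compact : compact [set: M]) (M_connected : connected [set: M])
  (M_csc : constant_scalar_curv w)
  (mu : {measure set (borel M) -> \bar R}) (mu_vol : riemannian_volume w mu)
  (d : nat) (xi : 'I_d.+1 -> M -> R) (xi_basis : kernel_basis w xi)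
  (xi_0 : forall p, xi ord0 p = 1)
  (xi_mean : forall i : 'I_d, mean mu (xi (lift ord0 i)) = 0) :
  (forall m : nat, (d.+1 <= m)%N -> open (@balancing_points R M d m xi)) /\
  (exists2 m0 : nat, (d.+1 <= m0)%N &
     forall m : nat, (m0 <= m)%N -> @balancing_points R M d m xi !=set0).
Proof.
have [xi_ker xi_free _] := xi_basis.
have xi_cont i : continuous (xi i) by exact: kernel_continuous (xi_ker i).
split=> [[//|m] _|].
  rewrite (_ : balancing_points xi = [set p | \rank (eval_mx xi p) = d /\
      exists2 v, positive_cone v & eval_mx xi p *m v = 0]).
    apply: open_full_rank_positive_kernel => i j p.
    pose MM := prod_topology (fun _ : 'I_m.+1 => M).
    pose ev (q : MM) := xi (lift ord0 i) (q j).
    rewrite (_ : (fun t => _) = ev); last by apply/funext => q; rewrite mxE.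
    apply: (@continuous_comp _ _ _ (fun q : MM => q j)).
      exact: proj_continuous.
    exact: xi_cont.
  by apply/seteqP; split=> p [rk /C2_neq0P].
have mu_fin : (mu setT < +oo)%E.
  exact: riemannian_volume_finite mu_vol M_compact.
have muT_gt0 : (0 < mu setT)%E.
  by apply: (riemannian_volume_gt0 _ _ mu_vol); [exact: openT | exists point].
have xi_pos : forall c : 'rV[R]_d, c != 0 ->
    exists p, 0 < \sum_i c 0 i * xi (lift ord0 i) p.
  apply: (mean_zero_positive_value mu) => //.
  - exact: riemannian_volume_gt0 mu_vol.
  - move=> i; have /eqP := xi_mean i; rewrite mulf_eq0 invr_eq0.
    move=> /orP[|/eqP //].
    by rewrite fine_eq0 ?ge0_fin_numE ?ltW // gt_eqF.
  - move=> c c0; apply/rowP => i; rewrite mxE.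
    (* A relation among xi_1, ..., xi_d is one with coefficient 0 at xi_0. *)
    pose c' (k : 'I_d.+1) := if unlift ord0 k is Some j then c 0 j else 0.
    have := xi_free c' _ (lift ord0 i); rewrite /c' liftK; apply => p.
    rewrite big_ord_recl unlift_none mul0r add0r -[RHS](c0 p).
    by apply: eq_bigr => j _; rewrite liftK.
(* Any m >= size s works: the points beyond those of s are arbitrary. *)
have [s sP] := finite_positive_points _ xi_pos.
exists (maxn d.+1 (size s)) => [|m]; first exact: leq_maxl.
rewrite geq_max => /andP[dm sm]; case: m dm sm => // m dm sm.
pose p (j : 'I_m.+1) := nth point s j.
have pos (c : 'rV[R]_d) : c != 0 -> exists j, 0 < (c *m eval_mx xi p) 0 j.
  move=> /sP[q qs cq]; have jm : (index q s < m.+1)%N.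
    by apply: leq_trans sm; rewrite index_mem.
  exists (Ordinal jm); rewrite mxE; under eq_bigr do rewrite mxE.
  by rewrite /p /= nth_index.
exists p; split; last exact/C2_neq0P/positive_kernel_vector.
apply/eqP; apply: inj_row_free => c cA; apply/eqP/negPn/negP => /pos[j].
by rewrite cA mxE ltxx.
Qed.
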